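(* $\text{\ss}_i\leq\mathfrak{c}$ and $\text{\ss}_o\leq\mathfrak{c}$. Consequently, $\text{\ss}\leq\mathfrak{c}$ as well.
   Context: $\mathfrak{c}$ is the cardinality of the continuum; $\mathbb{N}=\{1,2,3,\dots\}$. For $A\subseteq\mathbb{N}$, the subseries $\sum_{n\in A}a_n$ is summed in increasing order of the indices; if $A$ is finite it counts as convergent. A series is conditionally convergent if it converges but not absolutely. A series diverges by oscillation if its partial sums neither converge to a real number nor tend to $+\infty$ nor tend to $-\infty$. The subseries number $\text{\ss}$ is the smallest cardinality of a family $\mathcal{A}$ of subsets of $\mathbb{N}$ such that for every conditionally convergent series $\sum_{n\in\mathbb{N}}a_n$ of real numbers there is $A\in\mathcal{A}$ such that $\sum_{n\in A}a_n$ diverges. $\text{\ss}_i$ (respectively $\text{\ss}_o$) is defined in the same way, except that $\sum_{n\in A}a_n$ is required to diverge to $+\infty$ or to $-\infty$ (respectively, to diverge by oscillation). *)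

(* Defs.v *)
From mathcomp Require Import all_boot all_order all_algebra.
From mathcomp Require Import all_classical all_reals all_analysis.

Set Implicit Arguments.
Unset Strict Implicit.
Unset Printing Implicit Defensive.

Import Order.TTheory GRing.Theory Num.Theory.
Import numFieldNormedType.Exports.

Local Open Scope classical_set_scope.
Local Open Scope card_scope.
Local Open Scope ring_scope.

(* Series are indexed by nat, so the index n stands for the (n+1)-st positive
   integer. *)

Section Series.
Variable R : realType.

Definition conditionally_convergent (a : R^nat) : Prop :=
  cvgn (series a) /\ ~ cvgn [normed series a].

Definition diverges (s : R^nat) : Prop := ~ cvgn s.

Definition diverges_to_infinity (s : R^nat) : Prop :=
  s @ \oo --> +oo \/ s @ \oo --> -oo.

Definition diverges_by_oscillation (s : R^nat) : Prop :=
  [/\ ~ cvgn s, ~ (s @ \oo --> +oo) & ~ (s @ \oo --> -oo)].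

(* Only infinite sets have an increasing enumeration indexed by nat, so a
   finite A satisfies none of the divergence conditions below, in accordance
   with the convention that finite subseries converge. *)
Definition increasing_enumeration (A : set nat) (e : nat -> nat) : Prop :=
  increasing_seq e /\ range e = A.

(* The partial sums of the subseries of a along A, summed in increasing order
   of the indices, have the property D. *)
Definition subseries_satisfies (D : R^nat -> Prop) (a : R^nat) (A : set nat) :
    Prop :=
  exists2 e, increasing_enumeration A e & D (series (a \o e)).

Definition subseries_family (D : R^nat -> Prop) (F : set (set nat)) : Prop :=
  forall a, conditionally_convergent a ->
    exists2 A, F A & subseries_satisfies D a A.

End Series.

Definition least_cardinality T (P : set T -> Prop) (F : set T) : Prop :=
  P F /\ forall G, P G -> F #<= G.

(* A set of sets of naturals F represents the cardinal of the smallest families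
   for D, that is, the subseries number for [diverges] and its variants for
   [diverges_to_infinity] and [diverges_by_oscillation]. Such an F is unique up
   to equipotence. *)
Definition subseries_number (R : realType) (D : R^nat -> Prop)
    (F : set (set nat)) : Prop :=
  least_cardinality (subseries_family D) F.

(* Main.v *)
(* The family of all sets of naturals works in each of the three cases. The
   positive terms of a conditionally convergent series sum to +oo, which settles
   divergence to infinity. Since the negative terms sum to -oo too, one can
   collect positive terms until the sum reaches 1, then negative terms until it
   is at most 0, and so on; the resulting subseries oscillates. Among all
   families that work, one of least cardinality exists because cardinals are
   well-ordered, and it is at most as large as the powerset of the naturals,
   which embeds into the reals by ternary expansions. *)
Require Import Defs.
From mathcomp Require Import all_boot all_order all_algebra.
From mathcomp Require Import all_classical all_reals all_analysis.
From mathcomp Require Import ring lra zify.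

Import Order.TTheory GRing.Theory Num.Theory.
Import numFieldNormedType.Exports.

Local Open Scope classical_set_scope.
Local Open Scope card_scope.
Local Open Scope ring_scope.

(* Take a maximal set S of choice functions (f G \in G whenever P G) on which
   all the evaluations f |-> f G are injective. By maximality some evaluation is
   onto, and then G is equipotent to S, which injects into every set in P. *)
Lemma least_cardinality_exists {T} {P : set T -> Prop} {G0 : set T} :
  P G0 -> exists F, least_cardinality P F.
Proof.
move=> PG0.
pose Q (S : set (set T -> T)) :=
  (forall f G, S f -> P G -> G (f G)) /\
  (forall f g G, S f -> S g -> P G -> f G = g G -> f = g).
have [|S [[Sin Sinj] Smax]] := @Zorn_bigcup _ Q.
  move=> C CQ Ctot; split=> [f G [X CX Xf]|f g G [X CX Xf] [Y CY Yg]].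
    exact: (CQ _ CX).1.
  have [XY|YX] := Ctot _ _ CX CY.
  - exact: (CQ _ CY).2 (XY _ Xf) Yg.
  - exact: (CQ _ CX).2 Xf (YX _ Yg).
have [[G [PG GS]]|nosurj] :=
    pselect (exists G, P G /\ forall y, G y -> exists2 f, S f & f G = y).
  exists G; split=> // H PH.
  have /choice[h hP] : forall y, exists f, G y -> S f /\ f G = y.
    move=> y; have [/GS[f Sf fy]|nGy] := pselect (G y); first by exists f.
    by exists (fun=> y).
  suff [f] : $|{injfun G >-> H}| by exact: inj_card_le.
  apply/injfunPex; exists (fun y => h y H) => [y Gy|y z].
    by have [Sy _] := hP _ Gy; exact: (Sin _ _ Sy PH).
  move=> /set_mem Gy /set_mem Gz /= hyz.
  have [[Sy <-] [Sz <-]] := (hP _ Gy, hP _ Gz).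
  by rewrite (Sinj _ _ _ Sy Sz PH hyz).
(* If no evaluation is onto, a function [g] choosing a missed point of each [G] can be adjoined to
   [S], against maximality. *)
have miss G : P G -> exists y, G y /\ forall f, S f -> f G <> y.
  move=> PG; apply: contrapT => nG; apply: nosurj; exists G; split=> // y Gy.
  apply: contrapT => nf; apply: nG; exists y; split=> // f Sf fy.
  by apply: nf; exists f.
have [y0 _] := miss _ PG0.
have /choice[g gP] :
    forall G, exists y, P G -> G y /\ forall f, S f -> f G <> y.
  move=> G; have [/miss[y]|nPG] := pselect (P G); first by exists y.
  by exists y0.
exfalso; apply: (Smax (S `|` [set g])).
  split; first by move=> f; left.
  by move=> /(_ g (or_intror erefl)) Sg; exact: ((gP _ PG0).2 _ Sg).
split=> [f G [Sf|->] PG|f1 f2 G [S1|->] [S2|->] PG e //].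
- exact: (Sin _ _ Sf PG).
- exact: (gP _ PG).1.
- exact: (Sinj _ _ _ S1 S2 PG e).
- by case: ((gP _ PG).2 _ S1).
- by case: ((gP _ PG).2 _ S2).
Qed.

(** * Embedding the powerset of the naturals into the reals *)

Section SetNatReal.
Variable R : realType.

Let ternary (A : set nat) : R^nat := series (fun k => (k \in A)%:R * 3^-1 ^+ k).

Let third_gt0 n : 0 < 3^-1 ^+ n :> R.
Proof. by rewrite exprn_gt0// invr_gt0 ltr0n. Qed.

Let ternary_le (A : set nat) m n : (m <= n)%N ->
  ternary A m <= ternary A n <= ternary A m + 3 / 2 * 3^-1 ^+ m.
Proof.
(* The induction needs the exact sum of [3^-1 ^+ k] over [m <= k < n] as its upper bound. *)
suff : ternary A m <= ternary A (m + (n - m))%N <=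
    ternary A m + 3 / 2 * (3^-1 ^+ m - 3^-1 ^+ (m + (n - m))).
  move=> + mn; rewrite subnKC// => /andP[-> /le_trans]; apply.
  have := third_gt0 n; lra.
elim: (n - m)%N => [|k]; first by rewrite addn0 subrr mulr0 addr0 lexx.
rewrite addnS /ternary seriesSr /= exprS.
have := third_gt0 (m + k).
case: (_ \in _) => /=; lra.
Qed.

Let ternary_cvg A : cvgn (ternary A).
Proof.
apply: nondecreasing_is_cvgn => [m n /(ternary_le A)/andP[]//|].
exists (ternary A 0 + 3 / 2 * 3^-1 ^+ 0) => _ [n _ <-].
by have /andP[] := ternary_le A _ _ (leq0n n).
Qed.

Let ternary_lim A m :
  ternary A m <= limn (ternary A) <= ternary A m + 3 / 2 * 3^-1 ^+ m.
Proof.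
apply/andP; split.
- apply: limr_ge (ternary_cvg A) _; exists m => // n /=.
  by move=> /(ternary_le A)/andP[].
- apply: limr_le (ternary_cvg A) _; exists m => // n /=.
  by move=> /(ternary_le A)/andP[].
Qed.

Lemma card_le_set_nat_real : [set: set nat] #<= [set: R].
Proof.
apply/(@pcard_injP _ R); exists (fun A => limn (ternary A)) => A B _ _ eAB.
suff agree n : (n \in A) = (n \in B).
  apply/seteqP; split=> n /mem_set nA; apply/set_mem.
    by rewrite -agree.
  by rewrite agree.
elim/ltn_ind: n => n IH.
have eqn : ternary A n = ternary B n.
  apply: eq_big_nat => k /andP[_ kn]; by rewrite IH.
(* If [A] and [B] first differ at [n], the sums differ there by [3^-1 ^+ n], while the later terms
   make up at most half of that. *)
have [LA LB] := (ternary_lim A n.+1, ternary_lim B n.+1).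
move: LA LB; rewrite eAB /ternary !seriesSr -!/(ternary _) eqn exprS.
have := third_gt0 n.
case: (n \in A); case: (n \in B) => //=; lra.
Qed.

End SetNatReal.

(** * Subseries as series with masked terms *)

Section Subseries.
Context {R : realType}.
Implicit Types (a p s : R^nat) (A : pred nat).

Definition mask a A : R^nat := fun n => if A n then a n else 0.

Lemma mask_dvg_unbounded {a A} : ~ cvgn (series (mask a A)) ->
  forall N, exists2 n, (N <= n)%N & A n.
Proof.
move=> dv N; apply: contrapT => nA; apply: dv.
apply: (is_cvg_near_cst (series (mask a A) N)); exists N => // n /= Nn.
rewrite -(subnKC Nn); elim: (n - N)%N => [|k IH]; first by rewrite addn0.
rewrite addnS seriesSr IH /mask; case: ifP => [Ak|_]; last by rewrite addr0.
by case: nA; exists (N + k)%N => //; exact: leq_addr.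
Qed.

(* c n counts the elements of A below n, so that c is a left inverse of the
   enumeration e of A. *)
Lemma increasing_enumeration_mask {a A} : ~ cvgn (series (mask a A)) ->
  exists e c : nat -> nat, [/\ increasing_enumeration [set n | A n] e,
    c @ \oo --> \oo & series (mask a A) = series (a \o e) \o c].
Proof.
move=> /mask_dvg_unbounded Ainf; pose c n := count A (iota 0 n).
have cS n : c n.+1 = (c n + A n)%N.
  by rewrite /c -addn1 iotaD count_cat /= add0n addn0.
have c_homo : {homo c : m n / (m <= n)%N}.
  by apply: homo_leq => // [n|n]; [exact: leq_trans|rewrite cS leq_addr].
have c_inf n : exists N, (n < c N)%N.
  elim: n => [|n [N nN]].
    have [k _ Ak] := Ainf 0; exists k.+1; by rewrite cS Ak addn1.
  have [k Nk Ak] := Ainf N; exists k.+1.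
  by rewrite cS Ak addn1 ltnS (leq_trans nN)// c_homo.
have c_inj m n : A m -> A n -> c m = c n -> m = n.
  move=> Am An; case: (ltngtP m n) => // /c_homo; rewrite cS ?Am ?An; lia.
have /choice[e eP] : forall n, exists k, A k /\ c k = n.
  (* The least argument at which [c] exceeds [n] is not 0; its predecessor [k] is the element of [A]
     with exactly [n] elements of [A] below it. *)
  move=> n; case: (ex_minnP (c_inf n)) => -[|k]; first by rewrite /c.
  rewrite cS => nk kmin; exists k.
  have := kmin k; rewrite ltnn; case: (A k) nk => /=; lia.
have ce k : A k -> e (c k) = k.
  by move=> Ak; have [Ae cek] := eP (c k); exact: c_inj.
exists e, c; split; first split.
- apply/increasing_seqP => n; rewrite ltEnat /= ltnNge; apply/negP => /c_homo.
  by rewrite !(eP _).2 ltnn.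
- apply/seteqP; split=> [_ [n _ <-]|k /= Ak]; first exact: (eP n).1.
  by exists (c k) => //; exact: ce.
- apply/cvgnyPge => n; have [N nN] := c_inf n.
  by exists N => // m /= /c_homo; apply: leq_trans; exact: ltnW.
- apply/funext => n /=; elim: n => [|n IH].
    by rewrite /series /= !big_geq.
  rewrite seriesSr IH cS /mask; case: ifP => [An|_].
    by rewrite addn1 seriesSr /= ce.
  by rewrite addr0 addn0.
Qed.

(** Since [|x| = 2 max(x, 0) - x], convergence here would make [a] absolutely convergent. *)
Lemma positive_part_dvg {a} : conditionally_convergent a ->
  ~ cvgn (series (fun n => Num.max (a n) 0)).
Proof.
move=> [acv andv] pcv; apply: andv.
have := is_cvg_seriesB (is_cvg_seriesD pcv pcv) acv.
rewrite (_ : _ - a = (fun n => `|a n|))//; apply/funext => n /=.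
rewrite !fctE; case: (lerP (a n) 0) => an.
  by rewrite ler0_norm// !add0r.
by rewrite gtr0_norm// addrK.
Qed.

Lemma conditionally_convergentN {a} :
  conditionally_convergent a -> conditionally_convergent (- a).
Proof.
move=> [acv andv]; split; first by rewrite is_cvg_seriesN.
have /funext normE n : `|(- a) n| = `|a n| by rewrite normrN.
by rewrite /normed_series_of normE.
Qed.

Lemma subseries_to_infinity {a} : conditionally_convergent a ->
  subseries_satisfies (@diverges_to_infinity R) a [set n | 0 < a n].
Proof.
move=> /positive_part_dvg dv.
have maskE : mask a (fun n => 0 < a n) = (fun n => Num.max (a n) 0).
  by apply/funext => n; rewrite /mask; case: ltrP.
rewrite -maskE in dv.
have [e [c [enum cy maskc]]] := increasing_enumeration_mask dv.
(* Partial sums of positive terms increase, so they tend to [+oo] unless they converge; composition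
   with [c] would then make the masked series converge. *)
exists e => //; left; apply: nondecreasing_dvgn_lt.
  apply: nondecreasing_series => n _ _ /=; apply: ltW.
  have : range e (e n) by exists n.
  by rewrite enum.2.
by move=> cv; apply: dv; rewrite maskc; apply: cvgP; exact: cvg_comp cy cv.
Qed.

(** * Oscillation by the greedy strategy *)

Lemma oscillating {s} : (forall N, exists2 n, (N <= n)%N & 1 <= s n) ->
  (forall N, exists2 n, (N <= n)%N & s n <= 0) -> diverges_by_oscillation s.
Proof.
move=> s1 s0; split.
- move=> /cvg_ex[l sl]; have [l1|l1] := ltrP l 1.
    have [N _ Ns] := cvgr_lt _ sl _ l1; have [n /Ns /= sn] := s1 N.
    by rewrite leNgt sn.
  have [N _ Ns] := cvgr_gt _ sl _ (lt_le_trans ltr01 l1).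
  by have [n /Ns /= sn] := s0 N; rewrite leNgt sn.
- move=> /cvgryPge/(_ 1)[N _ Ns]; have [n /Ns /= sn] := s0 N.
  by move=> /(le_trans sn); rewrite ler10.
- move=> /cvgrNyPle/(_ 0)[N _ Ns]; have [n /Ns /= sn] := s1 N.
  by move=> /le_trans /(_ sn); rewrite ler10.
Qed.

(** This forces the greedy strategy to turn around: sums that forever collect the terms of [p] and
    stay below [M] would bound the partial sums of [p]. *)
Lemma dvg_series_unbounded {p s M N} : (forall n, 0 <= p n) ->
  ~ cvgn (series p) ->
  ~ forall n, (N <= n)%N -> s n.+1 = s n + p n /\ s n.+1 <= M.
Proof.
move=> p0 dv sP; apply: dv.
have p_homo : {homo series p : m n / (m <= n)%N >-> m <= n}.
  exact: nondecreasing_series.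
apply: nondecreasing_is_cvgn => //.
have sE k : s (N + k)%N = s N + series p (N + k)%N - series p N.
  elim: k => [|k IH]; first by rewrite addn0 addrK.
  by rewrite addnS seriesSr (sP _ (leq_addr _ _)).1 IH; ring.
exists (M - s N + series p N) => _ [n _ <-].
(* The bound [M] is known only at successors of indices from [N] on, hence the shift to
   [N + n.+1]. *)
apply: (@le_trans _ _ (series p (N + n.+1)%N)).
  by apply: p_homo; lia.
have := (sP _ (leq_addr n N)).2; rewrite -addnS sE; lra.
Qed.

(* Partial sum and current direction of the greedy strategy that collects
   positive terms until the sum reaches 1, then negative terms until it is
   at most 0, and so on. *)
Fixpoint zigzag a n : R * bool :=
  if n is m.+1 then
    let: (s, up) := zigzag a m in
    let s' := s + (if up then Num.max (a m) 0 else Num.min (a m) 0) in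
    (s', if up then s' < 1 else s' <= 0)
  else (0, true).

Definition zigzag_set a n := if (zigzag a n).2 then 0 < a n else a n < 0.

Lemma zigzagE a : series (mask a (zigzag_set a)) = fst \o zigzag a.
Proof.
apply/funext => n /=; elim: n => [|n IH]; first by rewrite /series /= big_geq.
rewrite seriesSr IH /mask /zigzag_set /=.
by case: (zigzag a n) => s [] /=; case: ltrP.
Qed.

Lemma max0_ge0 (x : R) : 0 <= Num.max x 0.
Proof. by rewrite le_max lexx orbT. Qed.

Lemma zigzag_up a N : conditionally_convergent a -> (zigzag a N).2 ->
  exists2 n, (N <= n)%N & 1 <= (zigzag a n).1 /\ ~~ (zigzag a n).2.
Proof.
move=> /positive_part_dvg dv upN; apply: contrapT => stay.
(* The direction flips only in a step that reaches 1, so without such a step it remains upward. *)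
have up n : (N <= n)%N -> (zigzag a n).2.
  move=> /subnKC <-; elim: (n - N)%N => [|k]; first by rewrite addn0.
  rewrite addnS => up; apply: contrapT => /negP down; apply: stay.
  exists (N + k).+1; first by rewrite ltnW// ltnS leq_addr.
  split=> //; move: up down => /=.
  by case: (zigzag a _) => s u /= ->; rewrite -leNgt.
have := @dvg_series_unbounded _ (fst \o zigzag a) 1 N
  (fun k => max0_ge0 _) dv; apply=> k Nk.
have := up k Nk; have := up k.+1 (leqW Nk).
by rewrite /=; case: (zigzag a k) => s u /= + uT; rewrite uT => /ltW.
Qed.

Lemma zigzag_down a N : conditionally_convergent a -> ~~ (zigzag a N).2 ->
  exists2 n, (N <= n)%N & (zigzag a n).1 <= 0 /\ (zigzag a n).2.
Proof.
move=> /conditionally_convergentN/positive_part_dvg dv downN.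
apply: contrapT => stay.
have down n : (N <= n)%N -> ~~ (zigzag a n).2.
  move=> /subnKC <-; elim: (n - N)%N => [|k]; first by rewrite addn0.
  rewrite addnS => down; apply/negP => up; apply: stay.
  exists (N + k).+1; first by rewrite ltnW// ltnS leq_addr.
  split=> //; move: down up => /=.
  by case: (zigzag a _) => s [].
(* Negated, the sums collect the positive parts of [- a] and stay below 0. *)
have := @dvg_series_unbounded _ (fun n => - (zigzag a n).1) 0 N
  (fun k => max0_ge0 _) dv; apply=> k Nk.
have := down k Nk; have := down k.+1 (leqW Nk).
rewrite /=; case: (zigzag a k) => s [] //= + _; rewrite -ltNge => /ltW s0.
by rewrite oppr_le0 opprD oppr_min oppr0.
Qed.

(** Both directions recur beyond every index, and each leads on to its threshold. *)
Lemma zigzag_oscillates {a} : conditionally_convergent a ->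
  diverges_by_oscillation (fst \o zigzag a).
Proof.
move=> acc; apply: oscillating => N.
- have [M NM up] : exists2 n, (N <= n)%N & (zigzag a n).2.
    case: (boolP (zigzag a N).2) => [|/(zigzag_down _ _ acc)[n Nn []]].
      by exists N.
    by exists n.
  have [n Mn []] := zigzag_up _ _ acc up.
  by exists n => //; exact: leq_trans Mn.
- have [M NM down] : exists2 n, (N <= n)%N & ~~ (zigzag a n).2.
    case: (boolP (zigzag a N).2) => [/(zigzag_up _ _ acc)[n Nn []]|].
      by exists n.
    by exists N.
  have [n Mn []] := zigzag_down _ _ acc down.
  by exists n => //; exact: leq_trans Mn.
Qed.

Lemma subseries_by_oscillation {a} : conditionally_convergent a ->
  subseries_satisfies (@diverges_by_oscillation R) a [set n | zigzag_set a n].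
Proof.
move=> /zigzag_oscillates; rewrite -zigzagE => -[dv npy nny].
have [e [c [enum cy maskc]]] := increasing_enumeration_mask dv.
(* As [c] tends to infinity, any limit of the enumerated sums would be one of the greedy sums. *)
exists e => //; rewrite maskc in dv npy nny; split.
- by move=> cv; apply: dv; apply: cvgP; exact: cvg_comp cy cv.
- by move=> cv; apply: npy; exact: cvg_comp cy cv.
- by move=> cv; apply: nny; exact: cvg_comp cy cv.
Qed.

Lemma subseries_number_le_continuum (D : R^nat -> Prop) :
  (forall a, conditionally_convergent a ->
    exists A, subseries_satisfies D a A) ->
  exists2 F, subseries_number D F & F #<= [set: R].
Proof.
move=> Dsub.
have famT : subseries_family D setT by move=> a /Dsub[A]; exists A.
have [F [FD Fmin]] := least_cardinality_exists famT.
exists F => //; apply: card_le_trans (card_le_set_nat_real R); exact: Fmin.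
Qed.

End Subseries.

Theorem theorem5 (R : realType) :
  [/\ exists2 ssi : set (set nat),
        subseries_number (@diverges_to_infinity R) ssi & ssi #<= [set: R],
      exists2 sso : set (set nat),
        subseries_number (@diverges_by_oscillation R) sso & sso #<= [set: R]
    & exists2 ss : set (set nat),
        subseries_number (@diverges R) ss & ss #<= [set: R]].
Proof.
split; apply: subseries_number_le_continuum => a acc.
- by eexists; exact: subseries_to_infinity.
- by eexists; exact: subseries_by_oscillation.
- have [e enum [dv _ _]] := subseries_by_oscillation acc.
  by eexists; exists e; first exact: enum.
Qed.
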